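(* Let $(M^7,g,\phi)$ be a $\mathrm{G}_2$-manifold, i.e. a 7-dimensional oriented Riemannian spin manifold with a unit spinor field $\phi$, with Levi-Civita connection $\nabla$, Dirac operator $D$, intrinsic endomorphism $S$ (so $\nabla_X\phi=S(X)\phi$) and cross product $\times$. Put $\lambda:=-\frac17(D\phi,\phi)$ (a real function) and $S\phi:=\sum_{i,j}g(e_i,S(e_j))\,e_ie_j\phi$ for an orthonormal frame $(e_i)$. Then the $\mathrm{G}_2$-structure is of the indicated class if and only if the corresponding condition holds (for all vectors $X,Y$): - $\mathcal{W}_1$: $\nabla_X\phi=\lambda X\phi$; - $\mathcal{W}_2$: $\nabla_{X\times Y}\phi=Y\nabla_X\phi-X\nabla_Y\phi+2g(Y,S(X))\phi$; - $\mathcal{W}_3$: $(X\nabla_Y\phi,\phi)=(Y\nabla_X\phi,\phi)$ and $\lambda=0$; - $\mathcal{W}_4$: at every point there is a tangent vector $V$ such that $\nabla_X\phi=XV\phi+g(V,X)\phi$ for all $X$; - $\mathcal{W}_{12}$: $\nabla_{X\times Y}\phi=Y\nabla_X\phi-X\nabla_Y\phi+g(Y,S(X))\phi-g(X,S(Y))\phi-\lambda(X\times Y)\phi$; - $\mathcal{W}_{13}$: $(X\nabla_Y\phi,\phi)=(Y\nabla_X\phi,\phi)$; - $\mathcal{W}_{14}$: at every point there are tangent vectors $V,W$ such that $\nabla_X\phi=XVW\phi-(XVW\phi,\phi)\phi$ for all $X$; - $\mathcal{W}_{23}$: $S\phi=0$ and $\lambda=0$; equivalently, $D\phi=0$; -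 $\mathcal{W}_{24}$: $(X\nabla_Y\phi,\phi)=-(Y\nabla_X\phi,\phi)$; - $\mathcal{W}_{34}$: $3(X\phi,\nabla_Y\phi)-3(Y\phi,\nabla_X\phi)=(S\phi,XY\phi)$ and $\lambda=0$; - $\mathcal{W}_{123}$: $(S\phi,X\phi)=0$; equivalently, $D\phi=-7\lambda\phi$; - $\mathcal{W}_{124}$: $(Y\nabla_X\phi,\phi)+(X\nabla_Y\phi,\phi)=-2\lambda\,g(X,Y)$; - $\mathcal{W}_{134}$: $3(X\phi,\nabla_Y\phi)-3(Y\phi,\nabla_X\phi)=(S\phi,XY\phi)-7\lambda\,g(X,Y)$; - $\mathcal{W}_{234}$: $\lambda=0$.
   Context: Conventions. $\Sigma$ is the real rank-8 spinor bundle of $M^7$, associated with the real 8-dimensional representation $\Delta=\mathbb{R}^8$ of the Clifford algebra of $\mathbb{R}^7$ (with $X^2=-|X|^2$) in which $e_1\cdots e_7$ acts as $-\mathrm{Id}$ for positively oriented orthonormal bases, with inner product $(\cdot,\cdot)$ for which vectors act skew-symmetrically. Clifford multiplication is written by juxtaposition. $\nabla$ is the Levi-Civita connection and its lift to $\Sigma$; $D=\sum_ie_i\nabla_{e_i}$. A unit spinor field $\phi$ induces a $\mathrm{G}_2$-structure with 3-form $\Psi_\phi(X,Y,Z)=(XYZ\phi,\phi)$ and cross product defined by $g(X\times Y,Z)=\Psi_\phi(X,Y,Z)$. Since $\Sigma=\mathbb{R}\phi\oplus\{X\phi:X\in TM\}$ pointwise, there is a unique endomorphism field $S$ of $TM$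 (the intrinsic endomorphism) with $\nabla_X\phi=S(X)\phi$. Classes. At each point $\mathrm{End}(T_pM)=\mathcal{W}_1\oplus\mathcal{W}_2\oplus\mathcal{W}_3\oplus\mathcal{W}_4$ with $\mathcal{W}_1=\mathbb{R}\,\mathrm{Id}$; $\mathcal{W}_2=\mathfrak{g}_2=\{A: A(X\times Y)=A(X)\times Y+X\times A(Y)\}$; $\mathcal{W}_3$ = symmetric traceless endomorphisms; $\mathcal{W}_4=\{X\mapsto V\times X: V\in T_pM\}$. Several indices denote direct sums, e.g. $\mathcal{W}_{13}=\mathcal{W}_1\oplus\mathcal{W}_3$. The $\mathrm{G}_2$-structure is ''of class $\mathcal{W}_{\ldots}$'' if $S$ lies in the corresponding sum at every point. *)

(* Defs.v *)
From mathcomp Require Import all_boot all_order all_algebra.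
From mathcomp Require Import all_classical all_reals all_analysis.

Set Implicit Arguments.
Unset Strict Implicit.
Unset Printing Implicit Defensive.

Import Order.TTheory GRing.Theory Num.Theory.
Import numFieldNormedType.Exports.
Local Open Scope classical_set_scope.
Local Open Scope ring_scope.

Section Euclidean.
Context {R : realType}.

Definition dot n (u v : 'cV[R]_n) : R := \sum_i u i 0 * v i 0.

(* [Ck k U f], for open [U]: partial derivatives of [f] of order <= k exist and
   are continuous on [U]. *)
Fixpoint Ck (k : nat) (U : set 'cV[R]_7) (f : 'cV[R]_7 -> R) : Prop :=
  match k with
  | 0 => forall y, U y -> {for y, continuous f}
  | k'.+1 => (forall y, U y -> differentiable f y) /\
             (forall v : 'cV[R]_7, Ck k' U (fun y => 'D_v f y))
  end.

Definition smooth_on (U : set 'cV[R]_7) (f : 'cV[R]_7 -> R) : Prop :=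
  forall k, Ck k U f.

Definition smooth_mx_on m n (U : set 'cV[R]_7) (F : 'cV[R]_7 -> 'M[R]_(m, n)) :=
  forall i j, smooth_on U (fun y => F y i j).

Definition Dmx m n (F : 'cV[R]_7 -> 'M[R]_(m, n)) (y v : 'cV[R]_7) :
    'M[R]_(m, n) :=
  \matrix_(i, j) 'D_v (fun z => F z i j) y.

Definition Jacobian (f : 'cV[R]_7 -> 'cV[R]_7) (y : 'cV[R]_7) : 'M[R]_7 :=
  \matrix_(i, j) 'D_(delta_mx j 0) (fun z => f z i 0) y.

End Euclidean.

(* Smooth 7-manifolds, given by an atlas.  A point of M together with a chart
   around it is recorded as a pair (a, y), with a : chart M and y in the image
   [cdom a] of that chart; the tangent space at this point is 'cV[R]_7, through
   the coordinate basis of the chart a.  Tensor and spinor fields are families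
   of local expressions (a, y) |-> _ obeying the appropriate transition rule. *)
Record manifold (R : realType) := Manifold {
  carrier :> topologicalType;
  carrier_hausdorff : hausdorff_space carrier;
  carrier_second_countable : @second_countable carrier;
  chart : Type;
  dom : chart -> set carrier;
  chart_map : chart -> carrier -> 'cV[R]_7;
  chart_inv : chart -> 'cV[R]_7 -> carrier;
  dom_open : forall a, open (dom a);
  dom_cover : forall p, exists a, dom a p;
  image_open : forall a, open (chart_map a @` dom a);
  chart_mapK : forall a p, dom a p -> chart_inv a (chart_map a p) = p;
  chart_map_continuous : forall a, {within dom a, continuous (chart_map a)};
  chart_inv_continuous : forall a,
    {within chart_map a @` dom a, continuous (chart_inv a)};
  transition_smooth : forall a b,
    smooth_mx_on (chart_map a @` (dom a `&` dom b))
      (fun y => chart_map b (chart_inv a y))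
}.

Section Geometry.
Context {R : realType}.
Implicit Type M : manifold R.

Definition cdom M (a : chart M) : set 'cV[R]_7 := chart_map a @` dom a.

Definition overlap M (a b : chart M) : set 'cV[R]_7 :=
  chart_map a @` (dom a `&` dom b).

Definition trans M (a b : chart M) (y : 'cV[R]_7) : 'cV[R]_7 :=
  chart_map b (chart_inv a y).

Definition jac M (a b : chart M) (y : 'cV[R]_7) : 'M[R]_7 :=
  Jacobian (trans a b) y.

(* The orientation of M is the one for which all charts are positive. *)
Definition oriented M : Prop :=
  forall (a b : chart M) y, overlap a b y -> 0 < \det (jac a b y).

Definition everywhere M (P : chart M -> 'cV[R]_7 -> Prop) : Prop :=
  forall (a : chart M) y, cdom a y -> P a y.

Record riemannian_metric M := RiemannianMetric {
  gmx : chart M -> 'cV[R]_7 -> 'M[R]_7;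
  gmx_smooth : forall a, smooth_mx_on (cdom a) (gmx a);
  gmx_sym : forall a y, cdom a y -> (gmx a y)^T = gmx a y;
  gmx_pos : forall a y, cdom a y -> forall X : 'cV[R]_7, X != 0 ->
    0 < dot X (gmx a y *m X);
  gmx_trans : forall a b y, overlap a b y ->
    gmx a y = (jac a b y)^T *m gmx b (trans a b y) *m jac a b y
}.

Definition gdot M (g : riemannian_metric M) (a : chart M)
    (y X Y : 'cV[R]_7) : R :=
  dot X (gmx g a y *m Y).

(* Christoffel symbol of the Levi-Civita connection, with upper index k. *)
Definition christoffel M (g : riemannian_metric M) (a : chart M)
    (y : 'cV[R]_7) (k i j : 'I_7) : R :=
  let dg l := Dmx (gmx g a) y (delta_mx l 0) in
  2^-1 * \sum_l invmx (gmx g a y) k l * (dg i j l + dg j i l - dg l i j).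

(* Levi-Civita derivative, in the direction X, of the vector field with local
   expression Y in the chart a. *)
Definition nablaLC M (g : riemannian_metric M) (a : chart M)
    (Y : 'cV[R]_7 -> 'cV[R]_7) (y X : 'cV[R]_7) : 'cV[R]_7 :=
  Dmx Y y X +
  \col_k \sum_i \sum_j christoffel g a y k i j * X i 0 * Y y j 0.

(* The real 8-dimensional representation of Cl(7) with X^2 = -|X|^2 and
   e_1 ... e_7 = -Id, in a basis of Delta that is orthonormal for the inner
   product. *)
Record spin_rep := SpinRep {
  gamma : 'I_7 -> 'M[R]_8;
  gamma_clifford : forall i j,
    gamma i * gamma j + gamma j * gamma i = (- (2 * (i == j)%:R))%:M;
  gamma_skew : forall i, (gamma i)^T = - gamma i;
  gamma_volume : \prod_(i < 7) gamma i = - 1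
}.

Definition clifford (Delta : spin_rep) (x : 'cV[R]_7) : 'M[R]_8 :=
  \sum_i x i 0 *: gamma Delta i.

(* Spin(7) is identified with its image under its faithful representation on
   Delta. *)
Definition Spin7 (Delta : spin_rep) : set 'M[R]_8 :=
  [set B | exists s : seq 'cV[R]_7,
    [/\ forall x, x \in s -> dot x x = 1, ~~ odd (size s)
      & B = \prod_(x <- s) clifford Delta x]].

(* A spin structure, presented over an atlas on whose chart domains it is
   trivial (every spin manifold has such an atlas): a positive orthonormal frame on every chart domain (the columns of
   [frame a y], in coordinates), and a cocycle with values in Spin(7) lifting
   the SO(7)-valued transition functions of these frames. *)
Definition frame_trans M (E : chart M -> 'cV[R]_7 -> 'M[R]_7)
    (a b : chart M) (y : 'cV[R]_7) : 'M[R]_7 :=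
  invmx (E b (trans a b y)) *m jac a b y *m E a y.

Record spin_structure (Delta : spin_rep) M (g : riemannian_metric M) :=
  SpinStructure {
  frame : chart M -> 'cV[R]_7 -> 'M[R]_7;
  frame_smooth : forall a, smooth_mx_on (cdom a) (frame a);
  frame_orthonormal : forall a y, cdom a y ->
    (frame a y)^T *m gmx g a y *m frame a y = 1%:M;
  frame_positive : forall a y, cdom a y -> 0 < \det (frame a y);
  spin_lift : chart M -> chart M -> 'cV[R]_7 -> 'M[R]_8;
  spin_lift_smooth : forall a b, smooth_mx_on (overlap a b) (spin_lift a b);
  spin_lift_spin : forall a b y, overlap a b y -> Spin7 Delta (spin_lift a b y);
  spin_lift_cover : forall a b y, overlap a b y -> forall x : 'cV[R]_7,
    spin_lift a b y *m clifford Delta x =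
    clifford Delta (frame_trans frame a b y *m x) *m spin_lift a b y;
  spin_lift_cocycle : forall a b c p, dom a p -> dom b p -> dom c p ->
    spin_lift b c (chart_map b p) *m spin_lift a b (chart_map a p) =
    spin_lift a c (chart_map a p)
}.

(* Sections of the spinor bundle associated with Delta, of length 1. *)
Record unit_spinor (Delta : spin_rep) M (g : riemannian_metric M)
    (P : spin_structure Delta g) := UnitSpinor {
  spinor : chart M -> 'cV[R]_7 -> 'cV[R]_8;
  spinor_smooth : forall a, smooth_mx_on (cdom a) (spinor a);
  spinor_trans : forall a b y, overlap a b y ->
    spinor b (trans a b y) = spin_lift P a b y *m spinor a y;
  spinor_unit : forall a y, cdom a y -> dot (spinor a y) (spinor a y) = 1
}.

Section SpinGeometry.
Context {Delta : spin_rep} {M : manifold R} {g : riemannian_metric M}.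

Definition e_ (P : spin_structure Delta g) (a : chart M) (y : 'cV[R]_7)
    (i : 'I_7) : 'cV[R]_7 := col i (frame P a y).

(* Clifford multiplication by the tangent vector X (in coordinates). *)
Definition cl (P : spin_structure Delta g) (a : chart M) (y X : 'cV[R]_7) :
    'M[R]_8 :=
  clifford Delta (\col_i gdot g a y X (e_ P a y i)).

(* Lift of the Levi-Civita connection: in the local frame (e_i),
   nabla_X psi = X(psi) + 1/2 sum_(i < j) g(nabla_X e_i, e_j) e_i e_j psi. *)
Definition nablaS (P : spin_structure Delta g) (a : chart M)
    (psi : 'cV[R]_7 -> 'cV[R]_8) (y X : 'cV[R]_7) : 'cV[R]_8 :=
  Dmx psi y X +
  2^-1 *: \sum_(i < 7) \sum_(j < 7 | (i < j)%N)
    gdot g a y (nablaLC g a (fun z => e_ P a z i) y X) (e_ P a y j) *: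
    (gamma Delta i *m gamma Delta j *m psi y).

Context {P : spin_structure Delta g} (phi : unit_spinor P).

Definition nabla_phi (a : chart M) (y X : 'cV[R]_7) : 'cV[R]_8 :=
  nablaS P a (spinor phi a) y X.

Definition Dirac_phi (a : chart M) (y : 'cV[R]_7) : 'cV[R]_8 :=
  \sum_i cl P a y (e_ P a y i) *m nabla_phi a y (e_ P a y i).

Definition lambda_phi (a : chart M) (y : 'cV[R]_7) : R :=
  - (7^-1 * dot (Dirac_phi a y) (spinor phi a y)).

Definition Psi (a : chart M) (y X Y Z : 'cV[R]_7) : R :=
  dot (cl P a y X *m cl P a y Y *m cl P a y Z *m spinor phi a y)
      (spinor phi a y).

(* The unique vector with g(X x Y, Z) = Psi(X, Y, Z) for all Z. *)
Definition cross (a : chart M) (y X Y : 'cV[R]_7) : 'cV[R]_7 :=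
  xget 0 [set T | forall Z, gdot g a y T Z = Psi a y X Y Z].

(* The unique endomorphism with nabla_X phi = S(X) phi for all X. *)
Definition intrinsic_endo (a : chart M) (y : 'cV[R]_7) : 'M[R]_7 :=
  xget 0 [set S : 'M[R]_7 | forall X,
    nabla_phi a y X = cl P a y (S *m X) *m spinor phi a y].

Definition S_phi (a : chart M) (y : 'cV[R]_7) : 'cV[R]_8 :=
  \sum_i \sum_j
    gdot g a y (e_ P a y i) (intrinsic_endo a y *m e_ P a y j) *:
    (cl P a y (e_ P a y i) *m cl P a y (e_ P a y j) *m spinor phi a y).

Definition W1 (a : chart M) (y : 'cV[R]_7) : set 'M[R]_7 :=
  [set A | exists c : R, A = c%:M].

Definition W2 (a : chart M) (y : 'cV[R]_7) : set 'M[R]_7 :=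
  [set A | forall X Y, A *m cross a y X Y =
    cross a y (A *m X) Y + cross a y X (A *m Y)].

Definition W3 (a : chart M) (y : 'cV[R]_7) : set 'M[R]_7 :=
  [set A | (forall X Y, gdot g a y (A *m X) Y = gdot g a y X (A *m Y)) /\
           \tr A = 0].

Definition W4 (a : chart M) (y : 'cV[R]_7) : set 'M[R]_7 :=
  [set A | exists V, forall X, A *m X = cross a y V X].

Definition sum_class (W W' : chart M -> 'cV[R]_7 -> set 'M[R]_7)
    (a : chart M) (y : 'cV[R]_7) : set 'M[R]_7 :=
  [set A + B | A in W a y & B in W' a y].

Definition of_class (W : chart M -> 'cV[R]_7 -> set 'M[R]_7) : Prop :=
  everywhere (fun a y => W a y (intrinsic_endo a y)).

End SpinGeometry.
End Geometry.

Arguments spin_rep : clear implicits.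
Declare Scope g2_class_scope.
Notation "W (+) W'" := (sum_class W W') (at level 50, left associativity)
  : g2_class_scope.
Delimit Scope g2_class_scope with W.

(* Main.v *)
(* Everything is pointwise.  Since f is a unit spinor, nabla_X f is orthogonal
   to f, and f, e_1 f, ..., e_7 f is an orthonormal basis, so S exists; with
   X Y f = - g(X, Y) f - (X x Y) f, all spinorial conditions become conditions
   on S, its trace and the vector w = sum_i e_i x S(e_i): for instance
   Dphi = - (tr S) f - w f and Sphi = - (tr S) f + w f.  The classes are then
   separated by two facts: a derivation of the cross product is skew with
   w = 0, and conversely a skew endomorphism with w = 0 is a derivation.  As
   w = 6 V for X |-> V x X, the W4-component of S is X |-> (w / 6) x X. *)
Require Import Defs.
From mathcomp Require Import all_boot all_order all_algebra.
From mathcomp Require Import all_classical all_reals all_analysis.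
From mathcomp Require Import ring lra.
From HB Require Import structures.

Set Implicit Arguments.
Unset Strict Implicit.
Unset Printing Implicit Defensive.

Import Order.TTheory GRing.Theory Num.Theory.
Import numFieldNormedType.Exports.
Local Open Scope classical_set_scope.
Local Open Scope ring_scope.

(** * Inner products, Clifford multiplication, derivatives *)

(** [W2] is given by the Leibniz rule alone, so skewness and w = 0 both have to be extracted from
    that rule. The two separating facts are entangled: skewness of a derivation is a trace argument,
    but w = 0 is deduced from the converse fact, applied after the cross part has been removed. Once
    both are available, each sum of classes is settled by writing its components down, with (tr S /
    7) Id as the scalar part. The cross product and S are chosen by [xget] with default 0. Their
    existence and all their algebra, bilinearity of the cross product included, come from splitting
    a spinor into a multiple of f and a vector times f. *)

Section Dot.
Context {R : realType}.

Lemma dotE n (u v : 'cV[R]_n) : dot u v = (u^T *m v) 0 0.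
Proof. by rewrite mxE; apply: eq_bigr => i _; rewrite mxE. Qed.

Lemma dotC n (u v : 'cV[R]_n) : dot u v = dot v u.
Proof. by apply: eq_bigr => i _; rewrite mulrC. Qed.

Lemma dot_is_linear n (u : 'cV[R]_n) : linear (dot u : 'cV[R]_n -> R^o).
Proof.
move=> k v w; rewrite !dotE mulmxDr -scalemxAr [LHS]mxE [X in X + _]mxE.
by [].
Qed.

HB.instance Definition _ n (u : 'cV[R]_n) :=
  GRing.isLinear.Build R 'cV[R]_n R^o _ (dot u) (dot_is_linear u).

Lemma dotDr n (u v w : 'cV[R]_n) : dot u (v + w) = dot u v + dot u w.
Proof. exact: linearD. Qed.

Lemma dotZr n k (u v : 'cV[R]_n) : dot u (k *: v) = k * dot u v.
Proof. exact: linearZ. Qed.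

Lemma dotNr n (u v : 'cV[R]_n) : dot u (- v) = - dot u v.
Proof. exact: linearN. Qed.

Lemma dotDl n (u v w : 'cV[R]_n) : dot (v + w) u = dot v u + dot w u.
Proof. by rewrite dotC dotDr !(dotC u). Qed.

Lemma dotZl n k (u v : 'cV[R]_n) : dot (k *: v) u = k * dot v u.
Proof. by rewrite dotC dotZr dotC. Qed.

Lemma dotNl n (u v : 'cV[R]_n) : dot (- v) u = - dot v u.
Proof. by rewrite dotC dotNr dotC. Qed.

Lemma dot_sumr n (u : 'cV[R]_n) I r (Q : pred I) F :
  dot u (\sum_(i <- r | Q i) F i) = \sum_(i <- r | Q i) dot u (F i).
Proof. exact: (linear_sum (dot u)). Qed.

Lemma dot_suml n (u : 'cV[R]_n) I r (Q : pred I) F :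
  dot (\sum_(i <- r | Q i) F i) u = \sum_(i <- r | Q i) dot (F i) u.
Proof. by rewrite dotC dot_sumr; apply: eq_bigr => i _; rewrite dotC. Qed.

Lemma dot_mulmxl m n (A : 'M[R]_(m, n)) u v :
  dot (A *m u) v = dot u (A^T *m v).
Proof. by rewrite !dotE trmx_mul mulmxA. Qed.

End Dot.

Section Entries.
Context {V : pzRingType} {m n : nat}.
Implicit Types A B : 'M[V]_(m, n).

Lemma entryD A B i j : (A + B) i j = A i j + B i j. Proof. exact: mxE. Qed.

Lemma entryN A i j : (- A) i j = - A i j. Proof. exact: mxE. Qed.

Lemma entryZ k A i j : (k *: A) i j = k * A i j. Proof. exact: mxE. Qed.

Lemma entry0 i j : (0 : 'M[V]_(m, n)) i j = 0. Proof. exact: mxE. Qed.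

Definition entryE := (entryD, entryN, entryZ, entry0).

End Entries.

Section Clifford.
Context {R : realType} (Delta : spin_rep R).

Lemma clifford_is_linear : linear (clifford Delta).
Proof.
move=> k x y; rewrite /clifford scaler_sumr -big_split.
by apply: eq_bigr => i _; rewrite /= !mxE scalerDl scalerA.
Qed.

HB.instance Definition _ :=
  GRing.isLinear.Build R 'cV[R]_7 'M[R]_8 _ (clifford Delta) clifford_is_linear.

Lemma clifford_anticomm x y :
  clifford Delta x *m clifford Delta y + clifford Delta y *m clifford Delta x
  = (- (2 * dot x y))%:M.
Proof.
have ee u v : clifford Delta u *m clifford Delta v =
    \sum_i \sum_j (u i 0 * v j 0) *: (gamma Delta i * gamma Delta j).
  rewrite mulmx_suml; apply: eq_bigr => i _.
  rewrite mulmx_sumr; apply: eq_bigr => j _.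
  by rewrite -scalemxAl -scalemxAr scalerA.
rewrite !ee [X in _ + X]exchange_big -big_split /=.
transitivity (\sum_(i < 7) (- (2 * (x i 0 * y i 0)))%:M : 'M[R]_8).
  apply: eq_bigr => i _; rewrite -big_split /= (bigD1 i) //= big1 => [|j ij].
    rewrite addr0 [y i 0 * _]mulrC -scalerDr gamma_clifford eqxx.
    by rewrite scale_scalar_mx mulr1; congr _%:M; ring.
  rewrite [y j 0 * _]mulrC -scalerDr gamma_clifford eq_sym (negbTE ij).
  by rewrite mulr0 oppr0 raddf0 scaler0.
rewrite -raddf_sum /=; congr _%:M.
by rewrite /dot mulr_sumr -sumrN.
Qed.

Lemma clifford_skew x : (clifford Delta x)^T = - clifford Delta x.
Proof.
rewrite /clifford linear_sum -sumrN; apply: eq_bigr => i _.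
by rewrite linearZ /= gamma_skew scalerN.
Qed.

End Clifford.

Section Derivatives.
Context {R : realType}.
Implicit Types (U : set 'cV[R]_7) (y X : 'cV[R]_7).

Lemma smooth_mx_differentiable m n U (F : 'cV[R]_7 -> 'M[R]_(m, n)) y i j :
  smooth_mx_on U F -> U y -> differentiable (fun z => F z i j) y.
Proof. by move=> /(_ i j 1%N) [+ _] Uy; apply. Qed.

Lemma Dmx_is_linear m n U (F : 'cV[R]_7 -> 'M[R]_(m, n)) y :
  smooth_mx_on U F -> U y -> linear (Dmx F y).
Proof.
move=> sF Uy k X Y; apply/matrixP => i j; rewrite !mxE.
have d := smooth_mx_differentiable i j sF Uy.
by rewrite !deriveE // linearP.
Qed.

(** Differentiate the constant |F|^2 = 1. This is half of the orthogonality of nabla_X f and f. *)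
Lemma dot_Dmx_unit n U (F : 'cV[R]_7 -> 'cV[R]_n) y X :
  open U -> smooth_mx_on U F -> U y ->
  (forall z, U z -> dot (F z) (F z) = 1) -> dot (Dmx F y X) (F y) = 0.
Proof.
move=> oU sF Uy F1.
have dF i : is_derive y X (fun z => F z i 0) ('D_X (fun z => F z i 0) y).
  by apply/derivableP/diff_derivable/(smooth_mx_differentiable i 0 sF Uy).
have := @is_derive_sum _ _ _ n _ y X _ (fun i => is_deriveM (dF i) (dF i)).
move=> [_].
have -> : 'D_X (\sum_(i < n) ((fun z => F z i 0) * (fun z => F z i 0))) y = 0.
  (* |F|^2 is constant on U only, so it is compared with the constant 1 near y; this is where
     openness of U enters. *)
  rewrite -[RHS](derive_cst (1 : R) y X); apply: near_eq_derive.
  near=> z; rewrite /= -(F1 z); last by near: z; apply: open_nbhs_nbhs.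
  by rewrite fct_sumE.
move=> h; suff: dot (Dmx F y X) (F y) + dot (Dmx F y X) (F y) = 0 by lra.
rewrite /dot -big_split /= [RHS]h; apply: eq_bigr => i _.
by rewrite mxE /GRing.scale /= mulrC.
Unshelve. all: by end_near. Qed.

End Derivatives.

(** * Cross product algebra of a unit spinor *)

(* Products are generalized because [lra] compares atoms up to unfolding. *)
Ltac module_lra :=
  repeat match goal with
  | |- context [@mulmx ?V ?m ?n ?p ?A ?B] =>
      let r := fresh "r" in generalize (@mulmx V m n p A B) => r
  end; intros;
  let i := fresh "i" in let j := fresh "j" in
  apply/matrixP => i j;
  repeat match goal with
  | h : _ = _ |- _ => move: h => /matrixP/(_ i j)
  end;
  rewrite ?entryE; lra.

(* Metric G, orthonormal frame e, Clifford multiplication c, unit spinor f and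
   cross product cr at a point.  Working with abstract operations prevents
   unification from unfolding the geometric ones. *)
Record spinor_model (R : realType) (G : 'cV[R]_7 -> 'cV[R]_7 -> R)
    (e : 'I_7 -> 'cV[R]_7) (c : 'cV[R]_7 -> 'M[R]_8) (f : 'cV[R]_8)
    (cr : 'cV[R]_7 -> 'cV[R]_7 -> 'cV[R]_7) : Prop := SpinorModel {
  model_ipC : forall X Y, G X Y = G Y X;
  model_ip_linear : forall X, linear (G X : _ -> R^o);
  model_frame : forall i j, G (e i) (e j) = (i == j)%:R;
  model_expand : forall X, \sum_i G X (e i) *: e i = X;
  model_trace : forall A : 'M[R]_7, \sum_i G (e i) (A *m e i) = \tr A;
  model_adjoint : forall A : 'M[R]_7,
    exists B : 'M[R]_7, forall X Y, G (A *m X) Y = G X (B *m Y);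
  model_cl_linear : linear c;
  model_cl_swap : forall X Y (u : 'cV[R]_8),
    c X *m (c Y *m u) = - (2 * G X Y) *: u - c Y *m (c X *m u);
  model_dot_cl : forall X u v, dot (c X *m u) v = - dot u (c X *m v);
  model_unit : dot f f = 1;
  model_cl_cl_f : forall X Y,
    c X *m (c Y *m f) = - G X Y *: f - c (cr X Y) *m f
}.

Section Model.
Context {R : realType}.
Context {G : 'cV[R]_7 -> 'cV[R]_7 -> R} {e : 'I_7 -> 'cV[R]_7}.
Context {c : 'cV[R]_7 -> 'M[R]_8} {f : 'cV[R]_8}.
Context {cr : 'cV[R]_7 -> 'cV[R]_7 -> 'cV[R]_7}.
Hypothesis model : spinor_model G e c f cr.
Implicit Types (X Y Z V : 'cV[R]_7) (u v : 'cV[R]_8) (A B : 'M[R]_7).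

Lemma ipC X Y : G X Y = G Y X. Proof. exact: model_ipC model _ _. Qed.

Lemma ipDr X Y Z : G X (Y + Z) = G X Y + G X Z.
Proof. by have := model_ip_linear model X 1 Y Z; rewrite !scale1r. Qed.

Lemma ip0r X : G X 0 = 0.
Proof. by have := ipDr X 0 0; rewrite addr0; lra. Qed.

Lemma ipZr k X Y : G X (k *: Y) = k * G X Y.
Proof. by have := model_ip_linear model X k Y 0; rewrite addr0 ip0r addr0. Qed.

Lemma ipNr X Y : G X (- Y) = - G X Y.
Proof. by rewrite -scaleN1r ipZr mulN1r. Qed.

Lemma ipDl X Y Z : G (X + Y) Z = G X Z + G Y Z.
Proof. by rewrite ipC ipDr !(ipC Z). Qed.

Lemma ip0l X : G 0 X = 0. Proof. by rewrite ipC ip0r. Qed.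

Lemma ipZl k X Y : G (k *: X) Y = k * G X Y.
Proof. by rewrite ipC ipZr ipC. Qed.

Lemma ipNl X Y : G (- X) Y = - G X Y.
Proof. by rewrite ipC ipNr ipC. Qed.

Definition ipE := (ipDl, ipDr, ipNl, ipNr, ipZl, ipZr, ip0l, ip0r).

Lemma ip_sumr X n (F : 'I_n -> 'cV[R]_7) :
  G X (\sum_i F i) = \sum_i G X (F i).
Proof. exact: (big_morph (G X) (ipDr X) (ip0r X)). Qed.

Lemma ip_suml X n (F : 'I_n -> 'cV[R]_7) :
  G (\sum_i F i) X = \sum_i G (F i) X.
Proof. by rewrite ipC ip_sumr; apply: eq_bigr => i _; rewrite ipC. Qed.

Lemma ip_ext X Y : (forall Z, G X Z = G Y Z) -> X = Y.
Proof.
move=> XY; rewrite -(model_expand model X) -(model_expand model Y).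
by apply: eq_bigr => i _; rewrite XY.
Qed.

Lemma endo_ext A B : (forall X, A *m X = B *m X) -> A = B.
Proof.
move=> AB; apply/matrixP => i j.
by have /colP/(_ i) := AB (delta_mx j 0); rewrite -!colE !mxE.
Qed.

Lemma clDm X Y u : c (X + Y) *m u = c X *m u + c Y *m u.
Proof.
by have := model_cl_linear model 1 X Y; rewrite !scale1r => ->; rewrite mulmxDl.
Qed.

Lemma cl0m u : c 0 *m u = 0.
Proof. by have := clDm 0 0 u; rewrite addr0; module_lra. Qed.

Lemma clZm k X u : c (k *: X) *m u = k *: (c X *m u).
Proof.
have := model_cl_linear model k X 0; rewrite addr0 => ->.
by rewrite mulmxDl cl0m addr0 scalemxAl.
Qed.

Lemma clNm X u : c (- X) *m u = - (c X *m u).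
Proof. by rewrite -scaleN1r clZm scaleN1r. Qed.

Lemma cl_summ n (F : 'I_n -> 'cV[R]_7) u :
  c (\sum_i F i) *m u = \sum_i c (F i) *m u.
Proof.
exact: (big_morph (fun X => c X *m u) (fun X Y => clDm X Y u) (cl0m u)).
Qed.

Lemma cl_mulD X u v : c X *m (u + v) = c X *m u + c X *m v.
Proof. exact: mulmxDr. Qed.

Lemma cl_mulN X u : c X *m (- u) = - (c X *m u).
Proof. exact: mulmxN. Qed.

Lemma cl_mulZ k X u : c X *m (k *: u) = k *: (c X *m u).
Proof. by rewrite scalemxAr. Qed.

Definition clE := (clDm, clNm, clZm, cl0m, cl_mulD, cl_mulN, cl_mulZ).

Lemma endoD A X Y : A *m (X + Y) = A *m X + A *m Y.
Proof. exact: mulmxDr. Qed.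

Lemma endoDl A B X : (A + B) *m X = A *m X + B *m X.
Proof. exact: mulmxDl. Qed.

Lemma endoNl A X : (- A) *m X = - (A *m X).
Proof. exact: mulNmx. Qed.

Lemma endoZl k A X : (k *: A) *m X = k *: (A *m X).
Proof. by rewrite scalemxAl. Qed.

Lemma endo_scalar k X : (k%:M : 'M[R]_7) *m X = k *: X.
Proof. exact: mul_scalar_mx. Qed.

Lemma endoM A B X : (A *m B) *m X = A *m (B *m X).
Proof. by rewrite mulmxA. Qed.

Definition endoE := (endoDl, endoNl, endoZl, endoM, endo_scalar).

Lemma cl_sqr X u : c X *m (c X *m u) = - G X X *: u.
Proof. by have := model_cl_swap model X X u; module_lra. Qed.

Lemma dot_clf_f X : dot (c X *m f) f = 0.
Proof. by have := model_dot_cl model X f f; rewrite (dotC f); lra. Qed.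

Lemma dot_clf X Y : dot (c X *m f) (c Y *m f) = G X Y.
Proof.
rewrite (model_dot_cl model) (model_cl_cl_f model) dotDr dotZr dotNr.
by rewrite (dotC f (_ *m _)) dot_clf_f (model_unit model); lra.
Qed.

(** Pairing with f isolates the scalar, pairing with each Z f the vector. Every spinor equation
    below is split in this way. *)
Lemma clf_coords k l X Y :
  k *: f + c X *m f = l *: f + c Y *m f <-> k = l /\ X = Y.
Proof.
split=> [kX|[-> ->]//].
have kl : k = l.
  have := congr1 (fun u => dot u f) kX.
  by rewrite /= !dotDl !dotZl !dot_clf_f (model_unit model) !mulr1 !addr0.
split=> //; apply: ip_ext => Z.
by move: kX; rewrite kl -!dot_clf => /addrI ->.
Qed.

Lemma clf_inj X Y : c X *m f = c Y *m f -> X = Y.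
Proof.
by move=> XY; have [] := clf_coords 0 0 X Y; rewrite XY => /(_ erefl)[].
Qed.

(** This is the vector part of the Clifford relation applied to f. *)
Lemma crossC X Y : cr X Y = - cr Y X.
Proof.
apply: clf_inj; have := model_cl_swap model X Y f.
by rewrite !(model_cl_cl_f model) (ipC Y X) clNm; module_lra.
Qed.

Lemma cross_skew X Y Z : G (cr X Y) Z = - G Y (cr X Z).
Proof.
have := model_dot_cl model X (c Y *m f) (c Z *m f).
rewrite !(model_cl_cl_f model) !dotDl !dotDr !dotNl !dotNr dotZl dotZr !dot_clf.
by rewrite (dotC f (_ *m _)) !dot_clf_f; lra.
Qed.

Lemma crossrr X : cr X X = 0.
Proof. by have := crossC X X; module_lra. Qed.

Lemma ip_crossr X Y : G X (cr X Y) = 0.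
Proof. by have := cross_skew X X Y; rewrite crossrr ip0l; lra. Qed.

(** Linearity is inherited from G, through the skewness of X x _. *)
Lemma crossDr X Y Z : cr X (Y + Z) = cr X Y + cr X Z.
Proof.
apply: ip_ext => T; rewrite ipDl !cross_skew ipDl; ring.
Qed.

Lemma crossZr k X Y : cr X (k *: Y) = k *: cr X Y.
Proof. apply: ip_ext => T; rewrite ipZl !cross_skew ipZl; ring. Qed.

Lemma cross0r X : cr X 0 = 0.
Proof. by have := crossZr 0 X 0; rewrite !scale0r. Qed.

Lemma crossNr X Y : cr X (- Y) = - cr X Y.
Proof. by rewrite -scaleN1r crossZr scaleN1r. Qed.

Lemma crossDl X Y Z : cr (X + Y) Z = cr X Z + cr Y Z.
Proof. by rewrite crossC crossDr opprD -!crossC. Qed.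

Lemma crossZl k X Y : cr (k *: X) Y = k *: cr X Y.
Proof. by rewrite crossC crossZr -scalerN -crossC. Qed.

Lemma crossNl X Y : cr (- X) Y = - cr X Y.
Proof. by rewrite crossC crossNr -crossC. Qed.

Definition crossE := (crossDl, crossDr, crossNl, crossNr, crossZl, crossZr).

Lemma cross_sumr X n (F : 'I_n -> 'cV[R]_7) :
  cr X (\sum_i F i) = \sum_i cr X (F i).
Proof. exact: (big_morph (cr X) (crossDr X) (cross0r X)). Qed.

Lemma cross_suml X n (F : 'I_n -> 'cV[R]_7) :
  cr (\sum_i F i) X = \sum_i cr (F i) X.
Proof.
by rewrite crossC cross_sumr -sumrN; apply: eq_bigr => i _; rewrite -crossC.
Qed.

(** Compare the vector parts of X (X (Y f)) = - |X|^2 Y f. *)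
Lemma cross_cross X Y : cr X (cr X Y) = G X Y *: X - G X X *: Y.
Proof.
apply: clf_inj; have := cl_sqr X (c Y *m f).
rewrite (model_cl_cl_f model X Y) !clE (model_cl_cl_f model X (cr X Y)).
by rewrite ip_crossr; module_lra.
Qed.

Lemma cross_polar X Y Z : cr X (cr Y Z) + cr Y (cr X Z) =
  G X Z *: Y + G Y Z *: X - (2 * G X Y) *: Z.
Proof.
have := cross_cross (X + Y) Z.
by rewrite !crossE !ipE !cross_cross (ipC Y X); module_lra.
Qed.

(** The constant is 1 - 7: by [cross_cross] each term is g(Z, e_i) e_i - Z, and the first summands
    add up to Z. All later factors 6 come from here. *)
Lemma sum_cross_cross_frame Z : \sum_i cr (e i) (cr (e i) Z) = - (6 *: Z).
Proof.
transitivity (\sum_i (G Z (e i) *: e i - Z)).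
  apply: eq_bigr => i _.
  by rewrite cross_cross (ipC _ Z) (model_frame model) eqxx scale1r.
rewrite big_split /= (model_expand model) sumr_const card_ord.
by rewrite -scaler_nat; module_lra.
Qed.

Definition cross_mx X : 'M[R]_7 := \matrix_(i, j) cr X (delta_mx j 0) i 0.

Lemma cross_mxE X Y : cross_mx X *m Y = cr X Y.
Proof.
have -> : Y = \sum_j Y j 0 *: delta_mx j 0.
  by rewrite {1}[Y]matrix_sum_delta; apply: eq_bigr => j _; rewrite big_ord1.
rewrite mulmx_sumr cross_sumr; apply: eq_bigr => j _.
rewrite -scalemxAr crossZr -colE; congr (_ *: _).
by apply/colP => i; rewrite !mxE.
Qed.

(** * Symmetric and skew endomorphisms, derivations and the vector w *)

Definition symmetric A := forall X Y, G (A *m X) Y = G X (A *m Y).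
Definition skew A := forall X Y, G (A *m X) Y = - G X (A *m Y).
Definition derivation A :=
  forall X Y, A *m cr X Y = cr (A *m X) Y + cr X (A *m Y).
(* The vector w of the header, which determines the W4-component. *)
Definition twist A := \sum_i cr (e i) (A *m e i).

Lemma twistD A B : twist (A + B) = twist A + twist B.
Proof.
rewrite /twist -big_split; apply: eq_bigr => i _ /=.
by rewrite endoDl crossDr.
Qed.

Lemma twistN A : twist (- A) = - twist A.
Proof.
by rewrite /twist -sumrN; apply: eq_bigr => i _; rewrite endoNl crossNr.
Qed.

Lemma traceE A : \tr A = \sum_i G (e i) (A *m e i).
Proof. by rewrite (model_trace model). Qed.

Lemma symmetric_scalar k : symmetric k%:M.
Proof. by move=> X Y; rewrite !endo_scalar ipZl ipZr. Qed.

Lemma symmetricD A B : symmetric A -> symmetric B -> symmetric (A + B).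
Proof. by move=> sA sB X Y; rewrite !endoDl ipDl ipDr sA sB. Qed.

Lemma skewD A B : skew A -> skew B -> skew (A + B).
Proof. by move=> sA sB X Y; rewrite !endoDl ipDl ipDr sA sB opprD. Qed.

Lemma skewN A : skew A -> skew (- A).
Proof. by move=> sA X Y; rewrite !endoNl ipNl ipNr sA. Qed.

Lemma skew_cross V : skew (cross_mx V).
Proof. by move=> X Y; rewrite !cross_mxE cross_skew. Qed.

Lemma skewP A : (forall X, G X (A *m X) = 0) -> skew A.
Proof.
move=> A0 X Y; have := A0 (X + Y).
rewrite endoD !ipE !A0 (ipC Y); lra.
Qed.

Lemma skew_trace A : skew A -> \tr A = 0.
Proof.
move=> sA; rewrite traceE big1 // => i _.
by have := sA (e i) (e i); rewrite ipC; lra.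
Qed.

(** Exhibits [twist] as the pairing of A with the operators Z x _ under the trace form. *)
Lemma ip_twist A Z : G (twist A) Z = - \tr (A *m cross_mx Z).
Proof.
rewrite ip_suml mxtrace_mulC traceE -sumrN; apply: eq_bigr => i _.
rewrite -mulmxA cross_mxE cross_skew (crossC _ Z) ipNr opprK.
by rewrite -[RHS]cross_skew ipC.
Qed.

(** A symmetric and a skew endomorphism are orthogonal for the trace form, and Z x _ is skew. *)
Lemma twist_symmetric A : symmetric A -> twist A = 0.
Proof.
move=> sA; apply: ip_ext => Z; rewrite ip0l ip_twist.
have : \tr (A *m cross_mx Z) = - \tr (cross_mx Z *m A).
  rewrite !traceE -sumrN; apply: eq_bigr => i _.
  by rewrite -!mulmxA -sA !cross_mxE ipC cross_skew.
by rewrite (mxtrace_mulC (cross_mx Z)); lra.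
Qed.

Lemma twist_cross V : twist (cross_mx V) = 6 *: V.
Proof.
rewrite -[RHS]opprK -sum_cross_cross_frame -sumrN; apply: eq_bigr => i _.
by rewrite cross_mxE (crossC V) crossNr.
Qed.

Lemma cross_mx_eq0 V : cross_mx V = 0 -> V = 0.
Proof.
move=> V0; have := twist_cross V; rewrite V0.
have -> : twist 0 = 0 by rewrite /twist big1 // => i _; rewrite mul0mx cross0r.
by module_lra.
Qed.

Lemma derivationD A B : derivation A -> derivation B -> derivation (A + B).
Proof. by move=> dA dB X Y; rewrite !endoDl dA dB !crossE; module_lra. Qed.

Lemma derivationN A : derivation A -> derivation (- A).
Proof. by move=> dA X Y; rewrite !endoNl dA !crossE; module_lra. Qed.

Lemma trace_cross_cross X Y : \tr (cross_mx X *m cross_mx Y) = - (6 * G X Y).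
Proof.
rewrite traceE -ipZr -ipNr -sum_cross_cross_frame ip_sumr.
apply: eq_bigr => i _; rewrite -mulmxA !cross_mxE.
have /(congr1 -%R) := cross_skew X (e i) (cr Y (e i)); rewrite opprK => <-.
rewrite (crossC X) (crossC Y) ipNl ipNr opprK.
by rewrite cross_skew opprK.
Qed.

(* For a derivation A one has L_{AX} = [A, L_X], where L_X = X x _, so that
   tr (L_{AX} L_X) = 0; but tr (L_X L_Y) = - 6 G X Y. *)
Lemma derivation_skew A : derivation A -> skew A.
Proof.
move=> dA; apply: skewP => X.
have -> : G X (A *m X) = - (6^-1 * \tr (cross_mx (A *m X) *m cross_mx X)).
  by rewrite trace_cross_cross ipC; field.
have -> : cross_mx (A *m X) = A *m cross_mx X - cross_mx X *m A.
  apply: endo_ext => Y; rewrite !endoE !cross_mxE dA.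
  by module_lra.
rewrite mulmxDl mulNmx linearD linearN /= -[in X in _ - X]mulmxA.
by rewrite (mxtrace_mulC (cross_mx X)) subrr mulr0 oppr0.
Qed.

(* Polarizing V x (V x _) turns the Leibniz rule for V x _ into
   V x (X x Y) = G V Y X - G V X Y, which a contraction shows to be absurd. *)
Lemma derivation_cross_eq0 V : derivation (cross_mx V) -> V = 0.
Proof.
move=> dV; apply: cross_mx_eq0; apply: endo_ext => Z; rewrite cross_mxE mul0mx.
have VXY X Y : cr V (cr X Y) = G V Y *: X - G V X *: Y.
  have := dV X Y; rewrite !cross_mxE (crossC (cr V X)).
  have := cross_polar X V Y; have := cross_polar Y V X.
  rewrite (ipC Y X) (ipC X V) (ipC Y V) (crossC Y X) crossNr.
  move: (cr _ _) (cr X (cr _ _)) (cr Y (cr _ _)) => a1 a2 a3.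
  by module_lra.
(* Put X = e_i and Y = e_i x Z in [VXY] and sum over i: this gives - 6 V x Z = - 2 V x Z, hence V x
   Z = 0. *)
have : cr V (- (6 *: Z)) = cr Z V - cr V Z.
  rewrite -sum_cross_cross_frame cross_sumr.
  transitivity (\sum_i (G (cr Z V) (e i) *: e i - cr (G V (e i) *: e i) Z)).
    apply: eq_bigr => i _; rewrite VXY crossZl; congr (_ *: _ - _).
    by rewrite (crossC (e i)) ipNr ipC [RHS]cross_skew ipC.
  by rewrite big_split /= sumrN -cross_suml !(model_expand model).
by rewrite crossNr crossZr (crossC Z); module_lra.
Qed.

Lemma sum_cl_cl A :
  \sum_i c (A *m e i) *m (c (e i) *m f) = - \tr A *: f + c (twist A) *m f.
Proof.
rewrite /twist cl_summ traceE -sumrN scaler_suml -big_split /=.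
apply: eq_bigr => i _; rewrite (model_cl_cl_f model) ipC.
by rewrite (crossC (A *m _)) clNm opprK.
Qed.

(* The element b = sum_i c(B e_i) c(e_i) satisfies [b, c X] = - 4 c(B X) and
   kills f, so computing b c(X) c(Y) f in two ways gives the Leibniz rule. *)
Lemma skew_twist0_derivation B : skew B -> twist B = 0 -> derivation B.
Proof.
move=> sB tB X Y; pose b := \sum_i c (B *m e i) *m c (e i).
have bE u : b *m u = \sum_i c (B *m e i) *m (c (e i) *m u).
  by rewrite /b mulmx_suml; apply: eq_bigr => i _; rewrite mulmxA.
have bf : b *m f = 0.
  by rewrite bE sum_cl_cl tB skew_trace // cl0m oppr0 scale0r addr0.
have BE Z : \sum_i G Z (e i) *: (B *m e i) = B *m Z.
  rewrite -[in RHS](model_expand model Z) mulmx_sumr.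
  by apply: eq_bigr => i _; rewrite scalemxAr.
(* Moving c Z to the left past each of the two factors of b produces - 2 c(B Z), for the factor c(B
   e_i) by skewness of B; together they make the 4. *)
have bX Z u : b *m (c Z *m u) = c Z *m (b *m u) - 4 *: (c (B *m Z) *m u).
  transitivity (\sum_i (- 2 *: (c (G Z (e i) *: (B *m e i)) *m u)
      - 2 *: (c (G (B *m Z) (e i) *: e i) *m u)
      + c Z *m (c (B *m e i) *m (c (e i) *m u)))).
    rewrite bE; apply: eq_bigr => i _.
    rewrite (model_cl_swap model (e i) Z) !clE.
    rewrite (model_cl_swap model (B *m e i) Z) sB.
    rewrite (ipC (e i) Z) (ipC (e i) (B *m Z)).
    by module_lra.
  rewrite !big_split /= sumrN -!scaler_sumr -!cl_summ BE (model_expand model).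
  by rewrite bE mulmx_sumr; module_lra.
have := congr1 (mulmx b) (model_cl_cl_f model X Y).
rewrite mulmxDr mulmxN -scalemxAr !bX bf !mulmx0 !sub0r scaler0 sub0r.
rewrite cl_mulN cl_mulZ !(model_cl_cl_f model) sB => h.
apply: clf_inj; rewrite clDm; move: h; module_lra.
Qed.

(** Removing V x _ with V = w / 6 leaves a skew endomorphism without twist, hence a derivation. So V
    x _ is itself a derivation, as a difference of two, and V = 0. *)
Lemma derivation_twist A : derivation A -> twist A = 0.
Proof.
move=> dA; pose V := 6^-1 *: twist A.
have tV : twist (cross_mx V) = twist A.
  by rewrite twist_cross scalerA mulfV ?scale1r // pnatr_eq0.
have dB : derivation (A - cross_mx V).
  apply: skew_twist0_derivation; last by rewrite twistD twistN tV subrr.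
  by apply: skewD; [exact: derivation_skew | apply/skewN/skew_cross].
have V0 : V = 0.
  apply: derivation_cross_eq0.
  have -> : cross_mx V = A - (A - cross_mx V) by rewrite subKr.
  exact/(derivationD dA)/derivationN.
by rewrite -tV twist_cross V0 scaler0.
Qed.

Lemma symmetric_skew_split A :
  exists B C, [/\ A = B + C, symmetric B & skew C].
Proof.
have [A' AA'] := model_adjoint model A.
have A'A X Y : G (A' *m X) Y = G X (A *m Y) by rewrite ipC -AA' ipC.
exists (2^-1 *: (A + A')), (2^-1 *: (A - A')); split.
- by module_lra.
- by move=> X Y; rewrite !endoE !ipE AA' A'A; lra.
- by move=> X Y; rewrite !endoE !ipE AA' A'A; lra.
Qed.

(** * Torsion classes *)

(** At a point of M these four sets unfold to [W1], ..., [W4], so results on the model apply there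
    by conversion. *)
Definition scalar_class : set 'M[R]_7 := [set A | exists k : R, A = k%:M].
Definition derivation_class : set 'M[R]_7 := [set A | derivation A].
Definition traceless_class : set 'M[R]_7 := [set A | symmetric A /\ \tr A = 0].
Definition cross_class : set 'M[R]_7 :=
  [set A | exists V, forall X, A *m X = cr V X].

Local Notation "P '\+' Q" := [set A + B | A in P & B in Q].
Local Notation D1 := scalar_class.
Local Notation D2 := derivation_class.
Local Notation D3 := traceless_class.
Local Notation D4 := cross_class.

Lemma trace_scalar k : \tr (k%:M : 'M[R]_7) = 7 * k.
Proof. by rewrite mxtrace_scalar mulr_natl. Qed.

Lemma traceD A B : \tr (A + B) = \tr A + \tr B.
Proof. exact: linearD. Qed.

Lemma traceN A : \tr (- A) = - \tr A.
Proof. exact: linearN. Qed.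

Lemma cross_class_mx A : D4 A -> exists V, A = cross_mx V.
Proof.
by move=> [V AV]; exists V; apply: endo_ext => X; rewrite AV cross_mxE.
Qed.

Lemma cross_mx_class V : D4 (cross_mx V).
Proof. by exists V => X; rewrite cross_mxE. Qed.

(** Derivations are skew, hence traceless, so the trace of A determines its scalar part. *)
Lemma scalar_derivation_trace A :
  (D1 \+ D2) A <-> derivation (A - (7^-1 * \tr A)%:M).
Proof.
split=> [[_ [k ->] [B dB <-]]|dA].
  rewrite traceD trace_scalar (skew_trace (derivation_skew dB)) addr0.
  by rewrite mulKf ?pnatr_eq0 // (addrC k%:M) addrK.
exists (7^-1 * \tr A)%:M; first by exists (7^-1 * \tr A).
by exists (A - (7^-1 * \tr A)%:M) => //; rewrite subrKC.
Qed.

Lemma traceless_part A :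
  symmetric A -> D3 (A - (7^-1 * \tr A)%:M).
Proof.
move=> sA; split.
  move=> X Y; have := symmetric_scalar (7^-1 * \tr A) X Y => h.
  by rewrite !endoDl !endoNl !ipE h sA.
by rewrite traceD traceN trace_scalar; field.
Qed.

Lemma scalar_traceless A : (D1 \+ D3) A <-> symmetric A.
Proof.
split=> [[_ [k ->] [B [sB _] <-]]|sA].
  exact: symmetricD (symmetric_scalar k) sB.
exists (7^-1 * \tr A)%:M; first by exists (7^-1 * \tr A).
by exists (A - (7^-1 * \tr A)%:M); [exact: traceless_part | rewrite subrKC].
Qed.

Lemma scalar_cross A :
  (D1 \+ D4) A <-> exists k V, forall X, A *m X = k *: X + cr V X.
Proof.
split=> [[_ [k ->] [B [V BV] <-]]|[k [V AV]]].
  by exists k, V => X; rewrite endoDl endo_scalar BV.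
exists k%:M; first by exists k.
exists (cross_mx V); first exact: cross_mx_class.
by apply: endo_ext => X; rewrite endoDl endo_scalar cross_mxE AV.
Qed.

(** The splitting of so(7) into g_2 and the endomorphisms V x _, with its projection made
    explicit. *)
Lemma skew_part_twist C : skew C -> derivation (C - cross_mx (6^-1 *: twist C)).
Proof.
move=> sC; apply: skew_twist0_derivation.
  exact/(skewD sC)/skewN/skew_cross.
rewrite twistD twistN twist_cross scalerA mulfV ?pnatr_eq0 // scale1r.
exact: subrr.
Qed.

Lemma derivation_cross A : (D2 \+ D4) A <-> skew A.
Proof.
split=> [[B dB [_ /cross_class_mx[V ->] <-]]|sA].
  exact: skewD (derivation_skew dB) (skew_cross V).
exists (A - cross_mx (6^-1 *: twist A)); first exact: skew_part_twist.
by exists (cross_mx (6^-1 *: twist A)); [exact: cross_mx_class | rewrite subrK].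
Qed.

(** The trace sees only the symmetric part of A and [twist] only the skew part, so each condition
    concerns one part. *)
Lemma derivation_traceless A : (D2 \+ D3) A <-> \tr A = 0 /\ twist A = 0.
Proof.
split=> [[B dB [C [sC tC] <-]]|[trA twA]].
  rewrite traceD twistD tC (skew_trace (derivation_skew dB)).
  by rewrite (derivation_twist dB) (twist_symmetric sC) !addr0.
have [B [C [AE sB sC]]] := symmetric_skew_split A; rewrite AE addrC.
exists C.
  apply: skew_twist0_derivation => //.
  by rewrite -twA AE twistD (twist_symmetric sB) add0r.
by exists B => //; split=> //; rewrite -trA AE traceD (skew_trace sC) addr0.
Qed.

Lemma scalar_derivation_traceless A : (D1 \+ D2 \+ D3) A <-> twist A = 0.
Proof.
split=> [[_ [_ [k ->] [B dB <-]] [C [sC _] <-]]|twA].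
  rewrite !twistD (twist_symmetric (symmetric_scalar k)) (derivation_twist dB).
  by rewrite (twist_symmetric sC) !addr0.
have [|B dB [C cC BC]] := (derivation_traceless (A - (7^-1 * \tr A)%:M)).2.
  rewrite traceD traceN trace_scalar twistD twistN twA.
  by rewrite (twist_symmetric (symmetric_scalar _)) subrr; split=> //; field.
exists ((7^-1 * \tr A)%:M + B);
  last by exists C => //; rewrite -addrA BC subrKC.
by exists (7^-1 * \tr A)%:M; [exists (7^-1 * \tr A) | exists B].
Qed.

Lemma scalar_derivation_cross A :
  (D1 \+ D2 \+ D4) A <-> skew (A - (7^-1 * \tr A)%:M).
Proof.
split=> [[_ [_ [k ->] [B dB <-]] [C cC <-]]|sA].
  have sBC : skew (B + C) by apply/derivation_cross; exists B => //; exists C.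
  rewrite -(addrA k%:M) traceD trace_scalar (skew_trace sBC) addr0.
  by rewrite mulKf ?pnatr_eq0 // (addrC k%:M) addrK.
have [B dB [C cC BC]] := (derivation_cross _).2 sA.
exists ((7^-1 * \tr A)%:M + B);
  last by exists C => //; rewrite -addrA BC subrKC.
by exists (7^-1 * \tr A)%:M; [exists (7^-1 * \tr A) | exists B].
Qed.

(** Once the cross part is removed, the skew part that remains is the W2-component; symmetry says
    that it vanishes. *)
Lemma traceless_cross A : (D3 \+ D4) A <->
  symmetric (A - cross_mx (6^-1 *: twist A)) /\ \tr A = 0.
Proof.
split=> [[B [sB tB] [_ /cross_class_mx[V ->] <-]]|[sA tA]].
  rewrite traceD tB (skew_trace (skew_cross V)) addr0; split=> //.
  rewrite twistD (twist_symmetric sB) add0r twist_cross scalerA.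
  by rewrite mulVf ?pnatr_eq0 // scale1r addrK.
exists (A - cross_mx (6^-1 *: twist A)).
  by split=> //; rewrite traceD traceN tA (skew_trace (skew_cross _)) subrr.
by exists (cross_mx (6^-1 *: twist A)); [exact: cross_mx_class | rewrite subrK].
Qed.

Lemma scalar_traceless_cross A : (D1 \+ D3 \+ D4) A <->
  symmetric (A - cross_mx (6^-1 *: twist A)).
Proof.
split=> [[B /scalar_traceless sB [_ /cross_class_mx[V ->] <-]]|sA].
  rewrite twistD (twist_symmetric sB) add0r twist_cross scalerA.
  by rewrite mulVf ?pnatr_eq0 // scale1r addrK.
exists (A - cross_mx (6^-1 *: twist A)); first exact/scalar_traceless.
by exists (cross_mx (6^-1 *: twist A)); [exact: cross_mx_class | rewrite subrK].
Qed.

Lemma derivation_traceless_cross A : (D2 \+ D3 \+ D4) A <-> \tr A = 0.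
Proof.
split=> [[B /derivation_traceless[tB _] [_ /cross_class_mx[V ->] <-]]|tA].
  by rewrite traceD tB (skew_trace (skew_cross V)) addr0.
exists (A - cross_mx (6^-1 *: twist A)).
  apply/derivation_traceless.
  rewrite traceD traceN tA (skew_trace (skew_cross _)).
  rewrite twistD twistN twist_cross scalerA mulfV ?pnatr_eq0 // scale1r.
  by rewrite !subrr.
by exists (cross_mx (6^-1 *: twist A)); [exact: cross_mx_class | rewrite subrK].
Qed.

(** * Spinorial conditions as conditions on the endomorphism *)

Section Conditions.
Variables (A : 'M[R]_7) (nb : 'cV[R]_7 -> 'cV[R]_8).
Hypothesis nbE : forall X, nb X = c (A *m X) *m f.

Let Dirac := \sum_i c (e i) *m nb (e i).
Let lam := - (7^-1 * dot Dirac f).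
Let Sphi := \sum_i \sum_j
  G (e i) (A *m e j) *: (c (e i) *m c (e j) *m f).

Lemma DiracE : Dirac = - \tr A *: f - c (twist A) *m f.
Proof.
rewrite /Dirac /twist cl_summ traceE -!sumrN scaler_suml -big_split /=.
by apply: eq_bigr => i _; rewrite nbE (model_cl_cl_f model).
Qed.

Lemma lamE : lam = 7^-1 * \tr A.
Proof.
rewrite /lam DiracE dotDl dotZl dotNl dot_clf_f (model_unit model); lra.
Qed.

Lemma lam_eq0 : lam = 0 <-> \tr A = 0.
Proof. by rewrite lamE; split; lra. Qed.

Lemma SphiE : Sphi = - \tr A *: f + c (twist A) *m f.
Proof.
rewrite -sum_cl_cl /Sphi exchange_big; apply: eq_bigr => j _ /=.
rewrite -[in RHS](model_expand model (A *m e j)) cl_summ.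
by apply: eq_bigr => i _; rewrite clZm mulmxA ipC.
Qed.

Lemma dot_cl_nb X Y : dot (c X *m nb Y) f = - G X (A *m Y).
Proof. by rewrite nbE (model_dot_cl model) dot_clf ipC. Qed.

Lemma dot_clf_nb X Y : dot (c X *m f) (nb Y) = G X (A *m Y).
Proof. by rewrite nbE dot_clf. Qed.

Lemma dot_Sphi_cl X : dot Sphi (c X *m f) = G (twist A) X.
Proof.
by rewrite SphiE dotDl dotZl dot_clf (dotC f) dot_clf_f mulr0 add0r.
Qed.

Lemma dot_Sphi_cl_cl X Y :
  dot Sphi (c X *m c Y *m f) = \tr A * G X Y - G (twist A) (cr X Y).
Proof.
rewrite -mulmxA (model_cl_cl_f model) dotDr dotZr dotNr dot_Sphi_cl.
rewrite SphiE dotDl dotZl dot_clf_f (model_unit model); lra.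
Qed.

(** The vector part is the right side of the Leibniz rule for A, which explains this combination in
    the conditions for W2 and W12. *)
Lemma cl_nb_swap X Y : c Y *m nb X - c X *m nb Y =
  (G X (A *m Y) - G Y (A *m X)) *: f + c (cr (A *m X) Y + cr X (A *m Y)) *m f.
Proof.
rewrite !nbE !(model_cl_cl_f model) (crossC (A *m X)) clDm clNm.
by module_lra.
Qed.

Lemma class1 : D1 A <-> forall X, nb X = lam *: (c X *m f).
Proof.
split=> [[k Ak] X|h].
  by rewrite nbE lamE Ak trace_scalar endo_scalar clZm mulKf // pnatr_eq0.
exists lam; apply: endo_ext => X; apply: clf_inj.
by rewrite -nbE h endo_scalar clZm.
Qed.

Lemma class2 : D2 A <-> forall X Y, nb (cr X Y) =
  c Y *m nb X - c X *m nb Y + (2 * G Y (A *m X)) *: f.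
Proof.
(* The scalar part of the condition says that A is skew, the vector part is the Leibniz rule. The
   former follows from the latter by [derivation_skew]. *)
have step X Y :
    nb (cr X Y) = c Y *m nb X - c X *m nb Y + (2 * G Y (A *m X)) *: f
    <-> 0 = G X (A *m Y) + G Y (A *m X) /\
        A *m cr X Y = cr (A *m X) Y + cr X (A *m Y).
  rewrite -clf_coords scale0r add0r cl_nb_swap nbE.
  by split=> ->; module_lra.
split=> [dA X Y|h X Y]; last by have /step[] := h X Y.
by apply/step; split; [rewrite (ipC Y) (derivation_skew dA) subrr | exact: dA].
Qed.

Lemma class13 : (D1 \+ D3) A <->
  forall X Y, dot (c X *m nb Y) f = dot (c Y *m nb X) f.
Proof.
rewrite scalar_traceless; split=> h X Y.
  by rewrite !dot_cl_nb -h ipC.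
by have := h X Y; rewrite !dot_cl_nb (ipC Y); lra.
Qed.

Lemma class3 : D3 A <->
  (forall X Y, dot (c X *m nb Y) f = dot (c Y *m nb X) f) /\ lam = 0.
Proof. by rewrite lam_eq0 -class13 scalar_traceless. Qed.

Lemma class4 : D4 A <->
  exists V, forall X, nb X = c X *m c V *m f + G V X *: f.
Proof.
have step V X : nb X = c X *m c V *m f + G V X *: f <-> A *m X = cr V X.
  rewrite -mulmxA (model_cl_cl_f model) nbE (ipC X) (crossC X) clNm.
  split=> [h|->]; last by module_lra.
  by apply: clf_inj; move: h; module_lra.
by split=> -[V h]; exists V => X; apply/step.
Qed.

(** The two g-terms cancel the scalar part of [cl_nb_swap]. What is left is the Leibniz rule for A -
    lam Id, to which the identity contributes lam - 2 lam = - lam. *)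
Lemma class12 : (D1 \+ D2) A <-> forall X Y, nb (cr X Y) =
  c Y *m nb X - c X *m nb Y + G Y (A *m X) *: f - G X (A *m Y) *: f
  - lam *: (c (cr X Y) *m f).
Proof.
rewrite scalar_derivation_trace -lamE.
split=> h X Y; have := h X Y; rewrite cl_nb_swap nbE.
  rewrite !endoE !crossE => {}h.
  suff -> : A *m cr X Y = cr (A *m X) Y + cr X (A *m Y) - lam *: cr X Y.
    by rewrite !clE; module_lra.
  by move: h; module_lra.
move=> {}h.
have {h} : A *m cr X Y = cr (A *m X) Y + cr X (A *m Y) - lam *: cr X Y.
  by apply: clf_inj; move: h; rewrite !clE; module_lra.
by rewrite !endoE !crossE; module_lra.
Qed.

(** Puts the condition for W14 into the form k X + U x X of [scalar_cross], with k = - g(V, W) and U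
    = - V x W. *)
Lemma cl_cl_cl_f X V W :
  c X *m c V *m c W *m f - dot (c X *m c V *m c W *m f) f *: f =
  c (- G V W *: X + cr X (cr V W)) *m f.
Proof.
rewrite -!mulmxA (model_cl_cl_f model V W) !clE (model_cl_cl_f model).
rewrite !dotDl !dotNl dotDl !dotNl !dotZl !dot_clf_f (model_unit model).
by module_lra.
Qed.

(** The plane of two frame vectors already contains such a W, also when V = 0. *)
Lemma orthogonal_vector V : exists2 W, G W W != 0 & G W V = 0.
Proof.
have ee := model_frame model.
pose i : 'I_7 := ord0; pose j : 'I_7 := lift ord0 ord0.
have [Vi|Vi] := eqVneq (G V (e i)) 0.
  by exists (e i); [rewrite ee eqxx oner_neq0 | rewrite ipC].
exists (G V (e j) *: e i - G V (e i) *: e j); last first.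
  by rewrite !ipE (ipC (e i)) (ipC (e j)); lra.
have -> : G (G V (e j) *: e i - G V (e i) *: e j)
            (G V (e j) *: e i - G V (e i) *: e j)
          = G V (e j) ^+ 2 + G V (e i) ^+ 2.
  by rewrite !ipE !ee /=; ring.
by rewrite gt_eqF // ltr_wpDl ?sqr_ge0 // lt_def sqr_ge0 sqrf_eq0 Vi.
Qed.

Lemma class14 : (D1 \+ D4) A <-> exists V W, forall X,
  nb X = c X *m c V *m c W *m f - dot (c X *m c V *m c W *m f) f *: f.
Proof.
rewrite scalar_cross; split=> [[k [U AU]]|[V [W h]]]; last first.
  exists (- G V W), (- cr V W) => X; apply: clf_inj.
  by rewrite -nbE h cl_cl_cl_f crossNl -crossC.
have [V V0 VU] := orthogonal_vector U.
(* W has to satisfy g(V, W) = - k and V x W = - U. Since V is orthogonal to U, V x (V x U) = - |V|^2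
   U, which yields this W. *)
exists V, ((G V V)^-1 *: (- k *: V + cr V U)) => X.
rewrite nbE cl_cl_cl_f AU !crossE crossrr cross0r scaler0 add0r cross_cross VU.
rewrite !ipE ip_crossr addr0 scale0r sub0r mulrCA mulVf // mulr1 opprK.
by rewrite !crossE scalerN scalerA mulVf // scale1r -crossC.
Qed.

Lemma class23 : (D2 \+ D3) A <-> Sphi = 0 /\ lam = 0.
Proof.
rewrite derivation_traceless lam_eq0 SphiE; split=> -[h1 h2].
  by rewrite h1 h2 cl0m oppr0 scale0r addr0.
split=> //; apply: clf_inj; move: h1.
by rewrite h2 cl0m oppr0 scale0r add0r.
Qed.

Lemma class23_Dirac : (D2 \+ D3) A <-> Dirac = 0.
Proof.
rewrite derivation_traceless DiracE; split=> [[-> ->]|h].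
  by rewrite cl0m subr0 oppr0 scale0r.
have [|h1 h2] := (clf_coords (- \tr A) 0 (- twist A) 0).1.
  by rewrite clNm h cl0m scale0r addr0.
by split; [lra | move: h2; module_lra].
Qed.

Lemma class24 : (D2 \+ D4) A <->
  forall X Y, dot (c X *m nb Y) f = - dot (c Y *m nb X) f.
Proof.
rewrite derivation_cross; split=> h X Y; have := h X Y; rewrite !dot_cl_nb.
  by rewrite (ipC Y) => ->; lra.
by rewrite (ipC Y); lra.
Qed.

(** The term (w / 6) x _ is skew, so it enters the symmetry equation twice; 2 / 6 = 1 / 3 accounts
    for the factor 3. *)
Lemma symmetric_sub_twist : symmetric (A - cross_mx (6^-1 *: twist A)) <->
  forall X Y, 3 * G X (A *m Y) - 3 * G Y (A *m X) = - G (twist A) (cr X Y).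
Proof.
have twX X Y : G (twist A) (cr X Y) = - G X (cr (twist A) Y).
  by rewrite ipC (crossC X) ipNl cross_skew opprK (crossC Y) ipNr.
split=> h X Y; have := h X Y; rewrite !endoE !cross_mxE !crossE !ipE.
all: by rewrite twX (cross_skew _ X Y) (ipC Y); lra.
Qed.

(** As 7 lam = tr A, the last term removes the part of (Sphi, X Y f) that is symmetric in X and
    Y. *)
Lemma class134 : (D1 \+ D3 \+ D4) A <-> forall X Y,
  3 * dot (c X *m f) (nb Y) - 3 * dot (c Y *m f) (nb X) =
  dot Sphi (c X *m c Y *m f) - 7 * lam * G X Y.
Proof.
rewrite scalar_traceless_cross symmetric_sub_twist lamE.
by split=> h X Y; have := h X Y; rewrite dot_Sphi_cl_cl !dot_clf_nb; lra.
Qed.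

Lemma class34 : (D3 \+ D4) A <->
  (forall X Y, 3 * dot (c X *m f) (nb Y) - 3 * dot (c Y *m f) (nb X) =
               dot Sphi (c X *m c Y *m f)) /\ lam = 0.
Proof.
rewrite traceless_cross -scalar_traceless_cross class134 lam_eq0.
split=> -[h tA]; split=> // X Y; have := h X Y; rewrite lamE tA; lra.
Qed.

Lemma class123 : (D1 \+ D2 \+ D3) A <-> forall X, dot Sphi (c X *m f) = 0.
Proof.
rewrite scalar_derivation_traceless; split=> [h X|h].
  by rewrite dot_Sphi_cl h ip0l.
by apply: ip_ext => X; rewrite -dot_Sphi_cl h ip0l.
Qed.

Lemma class123_Dirac :
  (D1 \+ D2 \+ D3) A <-> Dirac = - (7 * lam) *: f.
Proof.
rewrite scalar_derivation_traceless DiracE lamE mulVKf ?pnatr_eq0 //.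
split=> [->|h]; first by rewrite cl0m subr0.
by apply: clf_inj; move: h; rewrite cl0m; module_lra.
Qed.

Lemma class124 : (D1 \+ D2 \+ D4) A <->
  forall X Y, dot (c Y *m nb X) f + dot (c X *m nb Y) f = - (2 * lam * G X Y).
Proof.
rewrite scalar_derivation_cross -lamE; split=> h X Y; have := h X Y.
all: by rewrite !dot_cl_nb !endoE !ipE (ipC Y); lra.
Qed.

Lemma class234 : (D2 \+ D3 \+ D4) A <-> lam = 0.
Proof. by rewrite derivation_traceless_cross lam_eq0. Qed.

End Conditions.
End Model.

(** * The tangent space at a point of a spin manifold *)

Section Bilinear.
Context {R : realType} {Delta : spin_rep R} {M : manifold R}.
Context {g : riemannian_metric M} {P : spin_structure Delta g}.
Context {a : chart M} {y : 'cV[R]_7}.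
Local Notation G := (gdot g a y).
Implicit Types X Y Z : 'cV[R]_7.

Lemma gdot_is_linear X : linear (G X : 'cV[R]_7 -> R^o).
Proof. by move=> k Y Z; rewrite /gdot linearP /= linearP. Qed.

HB.instance Definition _ X :=
  GRing.isLinear.Build R 'cV[R]_7 R^o _ (gdot g a y X) (@gdot_is_linear X).

Lemma gdotDl X Y Z : G (X + Y) Z = G X Z + G Y Z.
Proof. exact: dotDl. Qed.

Lemma gdotZl k X Y : G (k *: X) Y = k * G X Y.
Proof. exact: dotZl. Qed.

Lemma gdotNl X Y : G (- X) Y = - G X Y.
Proof. exact: dotNl. Qed.

Lemma cl_is_linear : linear (cl P a y).
Proof.
move=> k X Y; rewrite /cl -linearP; congr clifford.
by apply/colP => i; rewrite !mxE gdotDl gdotZl.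
Qed.

HB.instance Definition _ :=
  GRing.isLinear.Build R 'cV[R]_7 'M[R]_8 _ (cl P a y) cl_is_linear.

Lemma dot_cl X u w : dot (cl P a y X *m u) w = - dot u (cl P a y X *m w).
Proof. by rewrite dot_mulmxl clifford_skew mulNmx dotNr. Qed.

End Bilinear.

Section Frame.
Context {R : realType} {Delta : spin_rep R} {M : manifold R}.
Context {g : riemannian_metric M} {P : spin_structure Delta g}.
Variables (a : chart M) (y : 'cV[R]_7).
Hypothesis ay : cdom a y.
Local Notation G := (gdot g a y).
Local Notation c := (cl P a y).
Local Notation e := (e_ P a y).
Implicit Types X Y Z : 'cV[R]_7.

Lemma gdotC X Y : G X Y = G Y X.
Proof. by rewrite /gdot dotC dot_mulmxl gmx_sym. Qed.

Lemma frameK : frame P a y *m ((frame P a y)^T *m gmx g a y) = 1%:M.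
Proof. exact/mulmx1C/frame_orthonormal. Qed.

Lemma coframeE X :
  \col_i G X (e i) = (frame P a y)^T *m gmx g a y *m X.
Proof.
apply/colP => i; rewrite mxE gdotC /gdot dotE -mulmxA.
rewrite [RHS]mxE [LHS]mxE; apply: eq_bigr => j _.
by rewrite !mxE.
Qed.

Lemma gdot_coframe X Y : dot (\col_i G X (e i)) (\col_i G Y (e i)) = G X Y.
Proof.
rewrite !coframeE dot_mulmxl trmx_mul trmxK gmx_sym // -!mulmxA.
by rewrite (mulmxA _^T) (mulmxA (frame P a y)) frameK mul1mx.
Qed.

Lemma frame_expand X : \sum_i G X (e i) *: e i = X.
Proof.
rewrite -[RHS]mul1mx -frameK -mulmxA -coframeE.
apply/colP => k; rewrite summxE [RHS]mxE; apply: eq_bigr => i _.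
by rewrite !mxE mulrC.
Qed.

Lemma gdot_frame i j : G (e i) (e j) = (i == j)%:R.
Proof.
have := frame_orthonormal P ay => /matrixP/(_ i j); rewrite [RHS]mxE => <-.
have := coframeE (e j) => /colP/(_ i); rewrite mxE gdotC => ->.
by rewrite /e_ colE mulmxA -colE mxE.
Qed.

Lemma trace_frame (A : 'M[R]_7) : \sum_i G (e i) (A *m e i) = \tr A.
Proof.
rewrite -[in RHS](mul1mx A) -frameK -mulmxA mxtrace_mulC.
apply: eq_bigr => i _; rewrite gdotC.
have := coframeE (A *m e i) => /colP/(_ i); rewrite mxE => ->.
by rewrite /e_ colE !mulmxA -colE mxE.
Qed.

Lemma gdot_ext X Y : (forall Z, G X Z = G Y Z) -> X = Y.
Proof.
move=> XY; rewrite -(frame_expand X) -(frame_expand Y).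
by apply: eq_bigr => i _; rewrite XY.
Qed.

Lemma adjoint_exists (A : 'M[R]_7) :
  exists B : 'M[R]_7, forall X Y, G (A *m X) Y = G X (B *m Y).
Proof.
(* This is g^-1 A^T g, with g^-1 written as E E^T for the frame matrix E. *)
exists (frame P a y *m (frame P a y)^T *m A^T *m gmx g a y) => X Y.
have GK : gmx g a y *m (frame P a y *m (frame P a y)^T) = 1%:M.
  by apply: mulmx1C; rewrite -mulmxA frameK.
by rewrite /gdot dot_mulmxl !mulmxA in GK *; rewrite GK mul1mx.
Qed.

Lemma cl_anticomm X Y : c X *m c Y + c Y *m c X = (- (2 * G X Y))%:M.
Proof. by rewrite clifford_anticomm gdot_coframe. Qed.

Lemma cl_swap n X Y (u : 'M[R]_(8, n)) :
  c X *m (c Y *m u) = - (2 * G X Y) *: u - c Y *m (c X *m u).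
Proof.
by apply/eqP; rewrite eq_sym subr_eq !mulmxA -mulmxDl cl_anticomm mul_scalar_mx.
Qed.

Lemma dot_cl_cl X Y u : dot (c X *m u) (c Y *m u) = G X Y * dot u u.
Proof.
have := congr1 (dot u) (cl_swap X Y u).
rewrite dotDr dotNr dotZr -[dot _ (c Y *m (c X *m u))]opprK -dot_cl.
rewrite (dotC u) dot_cl [dot (c Y *m u) _]dotC.
by lra.
Qed.

End Frame.

Section Cross.
Context {R : realType} {Delta : spin_rep R} {M : manifold R}.
Context {g : riemannian_metric M} {P : spin_structure Delta g}.
Variables (phi : unit_spinor P) (a : chart M) (y : 'cV[R]_7).
Hypothesis ay : cdom a y.
Local Notation G := (gdot g a y).
Local Notation c := (cl P a y).
Local Notation e := (e_ P a y).
Local Notation f := (spinor phi a y).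
Local Notation cr := (cross phi a y).
Implicit Types X Y Z : 'cV[R]_7.

Lemma dot_cl_spinor X Y : dot (c X *m f) (c Y *m f) = G X Y.
Proof. by rewrite dot_cl_cl // spinor_unit // mulr1. Qed.

Lemma dot_cl_f X : dot (c X *m f) f = 0.
Proof.
by have := dot_cl (P := P) (a := a) (y := y) X f f; rewrite (dotC f); lra.
Qed.

(* The orthonormal family f, e_1 f, ..., e_7 f has 8 elements, hence is a
   basis: the square matrix it forms is orthogonal. *)
Lemma spinor_expand u :
  u = dot u f *: f + \sum_i dot u (c (e i) *m f) *: (c (e i) *m f).
Proof.
pose N : 'M[R]_(8, 7) := \matrix_(i, j) (c (e j) *m f) i 0.
pose F : 'M[R]_(8, 1 + 7) := row_mx f N.
have colN j : col j N = c (e j) *m f by apply/colP => i; rewrite !mxE.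
have FF : F^T *m F = 1%:M.
  rewrite /F tr_row_mx mul_col_row scalar_mx_block.
  congr block_mx; apply/matrixP => i j.
  - by rewrite !ord1 -dotE spinor_unit // mxE eqxx.
  - rewrite ord1 [RHS]mxE -[RHS](dot_cl_f (e j)) dotC -colN dotE colE mulmxA.
    by rewrite -colE [RHS]mxE.
  - rewrite ord1 [RHS]mxE -[RHS](dot_cl_f (e i)) -colN dotE tr_col.
    by rewrite -row_mul [RHS]mxE.
  - rewrite [RHS]mxE -(gdot_frame (P := P) ay) -dot_cl_spinor -!colN dotE.
    rewrite tr_col.
    by rewrite -row_mul [RHS]mxE colE mulmxA -colE [RHS]mxE.
have {FF} : F *m F^T *m u = u.
  by have -> := mulmx1C (FF : (F : 'M[R]_8)^T *m F = 1%:M); rewrite mul1mx.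
rewrite /F tr_row_mx mul_row_col mulmxDl -!mulmxA => {1}<-.
congr (_ + _).
  apply/colP => i; rewrite mxE big_ord1 [RHS]mxE mulrC; congr (_ * _).
  by rewrite dotC dotE.
apply/colP => i; rewrite mxE summxE; apply: eq_bigr => j _.
rewrite [RHS]mxE mulrC -colN; congr (_ * _); last by rewrite [RHS]mxE.
by rewrite dotC dotE tr_col -row_mul [in RHS]mxE.
Qed.

Lemma spinor_decomp u : exists X, u = dot u f *: f + c X *m f.
Proof.
exists (\sum_i dot u (c (e i) *m f) *: e i).
rewrite [LHS]spinor_expand; congr (_ + _).
rewrite linear_sum mulmx_suml; apply: eq_bigr => i _.
by rewrite linearZ /= -scalemxAl.
Qed.

Lemma gdot_cross X Y Z : G (cr X Y) Z = Psi phi a y X Y Z.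
Proof.
move: Z; apply: (xgetPex 0
  (P := [set T | forall Z, G T Z = Psi phi a y X Y Z])).
(* Moving X and Y across the inner product gives Psi(X, Y, Z) = (Z f, Y X f), so the vector part of
   Y X f represents it. *)
have [T hT] := spinor_decomp (c Y *m (c X *m f)).
exists T => Z; rewrite /Psi -!mulmxA dot_cl dot_cl opprK hT.
by rewrite dotDr dotZr dot_cl_f mulr0 add0r dot_cl_spinor gdotC.
Qed.

(** [Psi] pairs Z f with Y X f. Exchanging X and Y changes the sign up to a multiple of f, which is
    orthogonal to Z f; hence the minus sign before the cross product. *)
Lemma cl_cl_f X Y : c X *m (c Y *m f) = - G X Y *: f - c (cr X Y) *m f.
Proof.
have [T hT] := spinor_decomp (c X *m (c Y *m f)).
rewrite hT dot_cl (dotC (c Y *m f)) dot_cl_spinor; congr (_ + _).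
rewrite -mulNmx -linearN; congr (c _ *m f).
apply: (gdot_ext (P := P) ay) => Z.
rewrite gdotNl gdot_cross /Psi -!mulmxA dot_cl dot_cl opprK.
rewrite (dotC (c Z *m f)) cl_swap // dotDl dotNl dotZl (dotC f) dot_cl_f mulr0.
rewrite add0r hT dotDl dotZl (dotC f) dot_cl_f mulr0 add0r dot_cl_spinor.
by lra.
Qed.

Lemma fibre_model : spinor_model G e c f cr.
Proof.
split.
- exact: gdotC.
- exact: gdot_is_linear.
- exact: gdot_frame.
- exact: frame_expand.
- exact: trace_frame.
- exact: (adjoint_exists (P := P) ay).
- exact: cl_is_linear.
- exact: cl_swap.
- exact: dot_cl.
- exact: spinor_unit.
- exact: cl_cl_f.
Qed.

End Cross.

(** * The intrinsic endomorphism *)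

Section Connection.
Context {R : realType} {Delta : spin_rep R} {M : manifold R}.
Context {g : riemannian_metric M} {P : spin_structure Delta g}.
Variables (phi : unit_spinor P) (a : chart M) (y : 'cV[R]_7).
Hypothesis ay : cdom a y.
Local Notation c := (cl P a y).
Local Notation f := (spinor phi a y).
Local Notation nb := (nabla_phi phi a y).

(** Linearity in the direction rests on smoothness of the frame: a directional derivative is linear
    in its direction at points of differentiability. *)
Lemma nablaLC_is_linear i : linear (nablaLC g a (fun z => e_ P a z i) y).
Proof.
have sE : smooth_mx_on (cdom a) (fun z => e_ P a z i).
  move=> k j; rewrite (_ : (fun z => _) = fun z => frame P a z k i).
    exact: frame_smooth.
  by apply/funext => z; rewrite mxE.
move=> k X Y; rewrite /nablaLC (Dmx_is_linear sE ay) scalerDr addrACA.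
congr (_ + _); apply/colP => l; rewrite !mxE mulr_sumr -big_split.
apply: eq_bigr => m _ /=; rewrite mulr_sumr -big_split.
by apply: eq_bigr => j _ /=; rewrite !mxE; ring.
Qed.

Lemma nabla_phi_is_linear : linear nb.
Proof.
move=> k X Y; rewrite /nabla_phi /nablaS.
rewrite (Dmx_is_linear (spinor_smooth phi a) ay).
rewrite scalerDr addrACA; congr (_ + _).
rewrite [k *: (2^-1 *: _)]scalerA [k * _]mulrC -scalerA -scalerDr.
congr (_ *: _); rewrite scaler_sumr -big_split; apply: eq_bigr => i _ /=.
rewrite scaler_sumr -big_split; apply: eq_bigr => j _ /=.
by rewrite nablaLC_is_linear gdotDl gdotZl scalerDl scalerA.
Qed.

(** A product of two anticommuting skew matrices is skew, so the connection term of [nablaS] is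
    orthogonal to the spinor it acts on. *)
Lemma dot_gamma_gamma i j u :
  i != j -> dot (gamma Delta i *m gamma Delta j *m u) u = 0.
Proof.
move=> ij.
have sk k v w : dot (gamma Delta k *m v) w = - dot v (gamma Delta k *m w).
  by rewrite dot_mulmxl gamma_skew mulNmx dotNr.
have ac : gamma Delta i *m gamma Delta j *m u =
    - (gamma Delta j *m gamma Delta i *m u).
  apply/eqP; rewrite -addr_eq0 -mulmxDl [X in X *m _](gamma_clifford Delta i j).
  by rewrite (negbTE ij) mulr0 oppr0 raddf0 mul0mx.
have := congr1 (fun v => dot v u) ac; rewrite /= dotNl -!mulmxA.
rewrite (sk i (gamma Delta j *m u)) (sk j (gamma Delta i *m u)).
by rewrite (dotC (gamma Delta i *m u)); lra.
Qed.

Lemma dot_nabla_phi X : dot (nb X) f = 0.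
Proof.
rewrite /nabla_phi /nablaS dotDl dotZl.
rewrite (dot_Dmx_unit X (@image_open _ M a) (spinor_smooth phi a) ay);
  last by move=> z az; exact: spinor_unit.
rewrite dot_suml big1 ?mulr0 ?addr0 // => i _.
rewrite dot_suml big1 // => j ij.
by rewrite dotZl dot_gamma_gamma ?mulr0 // neq_ltn ij.
Qed.

(** Existence is what [xget] requires: nabla f has no component along f, so each coordinate vector
    yields a column of S, and linearity does the rest. *)
Lemma intrinsic_endoP X : nb X = c (intrinsic_endo phi a y *m X) *m f.
Proof.
move: X; apply: (xgetPex 0
  (P := [set S : 'M[R]_7 | forall X, nb X = c (S *m X) *m f])).
have /choice[s sP] : forall j : 'I_7, exists Z, nb (delta_mx j 0) = c Z *m f.
  move=> j; have [Z hZ] := spinor_decomp phi ay (nb (delta_mx j 0)).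
  by exists Z; rewrite hZ dot_nabla_phi scale0r add0r.
pose nbl : {linear 'cV[R]_7 -> 'cV[R]_8} :=
  HB.pack nb (GRing.isLinear.Build _ _ _ _ nb nabla_phi_is_linear).
exists (\matrix_(i, j) s j i 0) => X.
have XE : X = \sum_j X j 0 *: delta_mx j 0.
  by rewrite {1}[X]matrix_sum_delta; apply: eq_bigr => j _; rewrite big_ord1.
rewrite {1}XE -[nb _]/(nbl _) linear_sum {2}XE mulmx_sumr linear_sum mulmx_suml.
apply: eq_bigr => j _; rewrite linearZ /= sP -scalemxAr linearZ /= -scalemxAl.
congr (_ *: (c _ *m f)); rewrite -colE; apply/colP => i; by rewrite !mxE.
Qed.

End Connection.

Lemma everywhere_iff (R : realType) (M : manifold R)
    (Q Q' : chart M -> 'cV[R]_7 -> Prop) :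
  (forall a y, cdom a y -> Q a y <-> Q' a y) -> everywhere Q <-> everywhere Q'.
Proof. by move=> QQ'; split=> h a y ay; apply/(QQ' a y ay)/h. Qed.

Theorem theorem4p8 (R : realType) (Delta : spin_rep R) (M : manifold R)
    (orM : oriented M) (g : riemannian_metric M) (P : spin_structure Delta g)
    (phi : unit_spinor P) :
  let W1 := @W1 R M in
  let W2 := W2 phi in
  let W3 := @W3 R M g in
  let W4 := W4 phi in
  let of_class := of_class phi in
  let f := spinor phi in
  let c := cl P in
  let nb := nabla_phi phi in
  let S := intrinsic_endo phi in
  let Dphi := Dirac_phi phi in
  let Sphi := S_phi phi in
  let lam := lambda_phi phi in
  let cr := cross phi in
  let G := gdot g in
  (of_class W1 <-> everywhere (fun (a : chart M) y => forall X,
     nb a y X = lam a y *: (c a y X *m f a y))) /\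
  (of_class W2 <-> everywhere (fun (a : chart M) y => forall X Y,
     nb a y (cr a y X Y) =
       c a y Y *m nb a y X - c a y X *m nb a y Y
       + (2 * G a y Y (S a y *m X)) *: f a y)) /\
  (of_class W3 <-> everywhere (fun (a : chart M) y =>
     (forall X Y, dot (c a y X *m nb a y Y) (f a y) =
                  dot (c a y Y *m nb a y X) (f a y)) /\
     lam a y = 0)) /\
  (of_class W4 <-> everywhere (fun (a : chart M) y => exists V, forall X,
     nb a y X = c a y X *m c a y V *m f a y + G a y V X *: f a y)) /\
  (of_class (W1 (+) W2)%W <-> everywhere (fun (a : chart M) y => forall X Y,
     nb a y (cr a y X Y) =
       c a y Y *m nb a y X - c a y X *m nb a y Y
       + G a y Y (S a y *m X) *: f a y - G a y X (S a y *m Y) *: f a y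
       - lam a y *: (c a y (cr a y X Y) *m f a y))) /\
  (of_class (W1 (+) W3)%W <-> everywhere (fun (a : chart M) y => forall X Y,
     dot (c a y X *m nb a y Y) (f a y) = dot (c a y Y *m nb a y X) (f a y))) /\
  (of_class (W1 (+) W4)%W <-> everywhere (fun (a : chart M) y =>
     exists V W, forall X,
     nb a y X = c a y X *m c a y V *m c a y W *m f a y
       - dot (c a y X *m c a y V *m c a y W *m f a y) (f a y) *: f a y)) /\
  ((of_class (W2 (+) W3)%W <-> everywhere (fun (a : chart M) y =>
     Sphi a y = 0 /\ lam a y = 0)) /\
   (of_class (W2 (+) W3)%W <-> everywhere (fun (a : chart M) y =>
     Dphi a y = 0))) /\
  (of_class (W2 (+) W4)%W <-> everywhere (fun (a : chart M) y => forall X Y,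
     dot (c a y X *m nb a y Y) (f a y) =
       - dot (c a y Y *m nb a y X) (f a y))) /\
  (of_class (W3 (+) W4)%W <-> everywhere (fun (a : chart M) y =>
     (forall X Y, 3 * dot (c a y X *m f a y) (nb a y Y)
                  - 3 * dot (c a y Y *m f a y) (nb a y X) =
                  dot (Sphi a y) (c a y X *m c a y Y *m f a y)) /\
     lam a y = 0)) /\
  ((of_class (W1 (+) W2 (+) W3)%W <-> everywhere (fun (a : chart M) y =>
     forall X, dot (Sphi a y) (c a y X *m f a y) = 0)) /\
   (of_class (W1 (+) W2 (+) W3)%W <-> everywhere (fun (a : chart M) y =>
     Dphi a y = - (7 * lam a y) *: f a y))) /\
  (of_class (W1 (+) W2 (+) W4)%W <-> everywhere (fun (a : chart M) y =>
     forall X Y, dot (c a y Y *m nb a y X) (f a y)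
                 + dot (c a y X *m nb a y Y) (f a y) =
                 - (2 * lam a y * G a y X Y))) /\
  (of_class (W1 (+) W3 (+) W4)%W <-> everywhere (fun (a : chart M) y =>
     forall X Y, 3 * dot (c a y X *m f a y) (nb a y Y)
                 - 3 * dot (c a y Y *m f a y) (nb a y X) =
                 dot (Sphi a y) (c a y X *m c a y Y *m f a y)
                 - 7 * lam a y * G a y X Y)) /\
  (of_class (W2 (+) W3 (+) W4)%W <-> everywhere (fun (a : chart M) y =>
     lam a y = 0)).
Proof.
move=> W1 W2 W3 W4 ofc f c nb S Dphi Sphi lam cr G.
have model a y (ay : cdom a y) := fibre_model phi ay.
have nbE a y (ay : cdom a y) := intrinsic_endoP phi ay.
split.
  apply: everywhere_iff => a y ay.
  exact: (class1 (model a y ay) (nbE a y ay)).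
split.
  apply: everywhere_iff => a y ay.
  exact: (class2 (model a y ay) (nbE a y ay)).
split.
  apply: everywhere_iff => a y ay.
  exact: (class3 (model a y ay) (nbE a y ay)).
split.
  apply: everywhere_iff => a y ay.
  exact: (class4 (model a y ay) (nbE a y ay)).
split.
  apply: everywhere_iff => a y ay.
  exact: (class12 (model a y ay) (nbE a y ay)).
split.
  apply: everywhere_iff => a y ay.
  exact: (class13 (model a y ay) (nbE a y ay)).
split.
  apply: everywhere_iff => a y ay.
  exact: (class14 (model a y ay) (nbE a y ay)).
split.
  split.
    apply: everywhere_iff => a y ay.
    exact: (class23 (model a y ay) (nbE a y ay)).
  apply: everywhere_iff => a y ay.
  exact: (class23_Dirac (model a y ay) (nbE a y ay)).
split.
  apply: everywhere_iff => a y ay.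
  exact: (class24 (model a y ay) (nbE a y ay)).
split.
  apply: everywhere_iff => a y ay.
  exact: (class34 (model a y ay) (nbE a y ay)).
split.
  split.
    apply: everywhere_iff => a y ay.
    (* This condition involves nabla f only through S, so the endomorphism itself is passed instead
       of its defining relation. *)
    exact: (class123 (model a y ay) (intrinsic_endo phi a y)).
  apply: everywhere_iff => a y ay.
  exact: (class123_Dirac (model a y ay) (nbE a y ay)).
split.
  apply: everywhere_iff => a y ay.
  exact: (class124 (model a y ay) (nbE a y ay)).
split.
  apply: everywhere_iff => a y ay.
  exact: (class134 (model a y ay) (nbE a y ay)).
apply: everywhere_iff => a y ay.
exact: (class234 (model a y ay) (nbE a y ay)).
Qed.
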